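(* Let $A_1=P_1J_1P_1^{-1}$ with $J_1=\begin{pmatrix}-n_1&1\\0&-n_1\end{pmatrix}$, $n_1>0$, and $A_2=P_2J_2P_2^{-1}$ with $J_2=\begin{pmatrix}n_2&1\\0&n_2\end{pmatrix}$, $n_2\ge0$; here $P_1,P_2$ are real invertible $2\times 2$ matrices with $|\det P_1|=|\det P_2|=1$, and $M=P_2^{-1}P_1=\begin{pmatrix}a&b\\c&d\end{pmatrix}$. Let $\eta>0$ be given. (i) If $c=0$, let $\tau_{1,2}(\eta)$ be the unique positive solution $t$ of $n_1t-\ln\theta(t)=n_2\eta+\sinh^{-1}\left(\frac{d^2}{2}\eta\right)$. (ii) If $c\neq0$, let $\tau_{1,2}(\eta)$ be the unique positive solution $t$ of $n_1t-\ln\theta(t)=n_2\eta+\sinh^{-1}\left(\frac{c^2}{2}\eta\right)$. Then the switched system $\dot x(t)=A_{\sigma(t)}x(t)$ is stable for all $\sigma\in\mathcal S[\tau_{1,2}(\eta),\eta]$ and asymptotically stable for all $\sigma\in\mathcal S'[\tau_{1,2}(\eta),\eta]$.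
   Context: $\theta(t)=\left\|\begin{pmatrix}1&t\\0&1\end{pmatrix}\right\|=\sqrt{1+\frac{t^2}{2}+t\sqrt{1+\frac{t^2}{4}}}$ (spectral norm). Planar switched system: $\dot x(t)=A_{\sigma(t)}x(t)$, $x(t)\in\mathbb R^2$ continuous in $t\ge0$, with $A_1,A_2$ real $2\times2$ matrices. A switching signal $\sigma:[0,\infty)\to\{1,2\}$ is right-continuous and piecewise constant with infinitely many discontinuities $0<d_1<d_2<\cdots$, $d_k\to\infty$; set $d_0=0$. For a signal with $\sigma(0)=1$ put $t_k=d_{2k-1}-d_{2k-2}$ (times spent in $A_1$) and $s_k=d_{2k}-d_{2k-1}$ (times spent in $A_2$), $k\ge1$. For $\tau,\eta>0$, $\mathcal S[\tau,\eta]$ is the set of signals with $\sigma(0)=1$, $t_k\ge\tau$ and $s_k\le\eta$ for all $k\in\mathbb N$; $\mathcal S'[\tau,\eta]$ is the set of $\sigma\in\mathcal S[\tau,\eta]$ for which the sequence $(t_k,s_k)_{k\ge1}$ does not converge to $(\tau,\eta)$. For a given signal $\sigma$, the system is stable if for every $\varepsilon'>0$ there is $\delta>0$ such that $\|x(0)\|<\delta$ implies $\|x(t)\|<\varepsilon'$ for all $t>0$; it is asymptotically stable if it is stable and $\|x(t)\|\to0$ as $t\to\infty$ for every $x(0)\in\mathbb R^2$. Vector norms are Euclidean. *)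

(* Defs.v *)
From HB Require Import structures.
From mathcomp Require Import all_boot all_order all_algebra.
From mathcomp Require Import all_classical all_reals all_analysis.
From mathcomp Require Import ring lra.

Set Implicit Arguments.
Unset Strict Implicit.
Unset Printing Implicit Defensive.

Import Order.TTheory GRing.Theory Num.Theory.
Import numFieldNormedType.Exports.
Local Open Scope classical_set_scope.
Local Open Scope ring_scope.

Definition mx2 (R : realType) (a b c d : R) : 'M[R]_2 :=
  \matrix_(i, j) nth 0 (nth [::] [:: [:: a; b]; [:: c; d]] i) j.

(* The library norm `|x| on matrices is the max norm (it induces the same
   topology on 'cV_2); the Euclidean norm has to be spelled out. *)
Definition enorm (R : realType) (x : 'cV[R]_2) : R :=
  Num.sqrt (\sum_i x i 0 ^+ 2).

Definition spectral_norm (R : realType) (A : 'M[R]_2) : R :=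
  sup [set enorm (A *m x) | x in [set x | enorm x = 1]].

Definition theta (R : realType) (t : R) : R := spectral_norm (mx2 1 t 0 1).

Definition sinh (R : realType) (x : R) : R := (expR x - expR (- x)) / 2.

Definition asinh (R : realType) (y : R) : R := ln (y + Num.sqrt (y ^+ 2 + 1)).

Inductive mode := Mode1 | Mode2.

(* Only the values of [sig_fun] on [0, +oo[ are meaningful.  The sequence
   [sig_time] is (d_k) with d_0 = 0; the last two fields say that the signal
   is constant on each [d_k, d_(k+1)[ (hence piecewise constant and
   right-continuous) and that every d_k with k >= 1 is a discontinuity, so
   [sig_time] is determined by [sig_fun]. *)
Record signal (R : realType) := Signal {
  sig_fun :> R -> mode ;
  sig_time : nat -> R ;
  sig_time0 : sig_time 0%N = 0 ;
  sig_time_lt : forall k, sig_time k < sig_time k.+1 ;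
  sig_time_pinfty : sig_time k @[k --> \oo] --> +oo ;
  sig_const : forall k t,
    sig_time k <= t < sig_time k.+1 -> sig_fun t = sig_fun (sig_time k) ;
  sig_jump : forall k, sig_fun (sig_time k.+1) <> sig_fun (sig_time k)
}.

(* Indices are shifted by one: [dwell1 sigma k] and [dwell2 sigma k] are
   t_(k+1) and s_(k+1). *)
Definition dwell1 (R : realType) (sigma : signal R) (k : nat) : R :=
  sig_time sigma k.*2.+1 - sig_time sigma k.*2.

Definition dwell2 (R : realType) (sigma : signal R) (k : nat) : R :=
  sig_time sigma k.*2.+2 - sig_time sigma k.*2.+1.

Definition dwell_flee (R : realType) (tau eta : R) : set (signal R) :=
  [set sigma : signal R | sigma 0 = Mode1 /\
     forall k, tau <= dwell1 sigma k /\ dwell2 sigma k <= eta].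

Definition dwell_flee' (R : realType) (tau eta : R) : set (signal R) :=
  [set sigma : signal R | dwell_flee tau eta sigma /\
     ~ ((dwell1 sigma k, dwell2 sigma k) @[k --> \oo] --> (tau, eta))].

Section system.
Variables (R : realType) (A1 A2 : 'M[R]_2) (sigma : signal R).

Definition mode_mx (m : mode) : 'M[R]_2 :=
  match m with Mode1 => A1 | Mode2 => A2 end.

(* Values of [x] at negative times are irrelevant; the differential equation
   is required at all positive times that are not switching times. *)
Definition is_solution (x : R -> 'cV[R]_2) : Prop :=
  {within `[0, +oo[, continuous x} /\
  forall t, 0 < t -> (forall k, t != sig_time sigma k) ->
    is_derive t 1 x (mode_mx (sigma t) *m x t).

Definition stable : Prop :=
  forall eps, 0 < eps -> exists2 delta, 0 < delta &
    forall x, is_solution x -> enorm (x 0) < delta ->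
      forall t, 0 < t -> enorm (x t) < eps.

Definition asymptotically_stable : Prop :=
  stable /\
  forall x, is_solution x -> enorm (x t) @[t --> +oo] --> 0.

End system.

Section facts.
Variable R : realType.
Implicit Types t x y : R.

Lemma sinhK : cancel (@sinh R) (@asinh R).
Proof.
move=> x; rewrite /asinh.
have e0 := expR_gt0 x.
have -> : sinh x ^+ 2 + 1 = ((expR x + expR (- x)) / 2) ^+ 2.
  by rewrite /sinh expRN; field; rewrite gt_eqF.
rewrite sqrtr_sqr ger0_norm; last first.
  by rewrite divr_ge0// addr_ge0// expR_ge0.
by rewrite /sinh -[RHS]expRK; congr ln; field.
Qed.

Lemma asinhK : cancel (@asinh R) (@sinh R).
Proof.
move=> y; rewrite /sinh /asinh.
set s := Num.sqrt _.
have s2 : s ^+ 2 = y ^+ 2 + 1 by rewrite sqr_sqrtr// addr_ge0// sqr_ge0.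
have s0 : 0 <= s by exact: sqrtr_ge0.
have ys0 : 0 < y + s by nra.
rewrite expRN lnK//.
have -> : (y + s)^-1 = s - y.
  apply: (mulfI (lt0r_neq0 ys0)); rewrite divff ?gt_eqF//.
  by rewrite addrC [RHS]mulrC -subr_sqr s2 addrAC subrr add0r.
by field.
Qed.

Lemma thetaE t : 0 <= t ->
  theta t = Num.sqrt (1 + t ^+ 2 / 2 + t * Num.sqrt (1 + t ^+ 2 / 4)).
Proof.
move=> t0.
set s := Num.sqrt (1 + t ^+ 2 / 4).
have s2 : s ^+ 2 = 1 + t ^+ 2 / 4.
  by rewrite sqr_sqrtr// addr_ge0// divr_ge0// sqr_ge0.
have s0 : 0 <= s by exact: sqrtr_ge0.
pose r := t / 2 + s.
have r0 : 0 < r by rewrite /r; nra.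
have rE : r ^+ 2 = r * t + 1 by rewrite /r; nra.
have -> : 1 + t ^+ 2 / 2 + t * s = r ^+ 2 by rewrite /r; nra.
rewrite sqrtr_sqr gtr0_norm//.
have sqE (x : 'cV[R]_2) : enorm x = Num.sqrt (x 0 0 ^+ 2 + x 1 0 ^+ 2).
  by rewrite /enorm !big_ord_recl big_ord0 addr0 !(ord1, lift0)//;
     congr (Num.sqrt (_ + x _ _ ^+ 2)); apply: val_inj.
have mE (x : 'cV[R]_2) : enorm (mx2 1 t 0 1 *m x) =
    Num.sqrt ((x 0 0 + t * x 1 0) ^+ 2 + x 1 0 ^+ 2).
  have e1 : lift ord0 ord0 = 1 :> 'I_2 by apply: val_inj.
  by rewrite sqE !mxE !big_ord_recl !big_ord0 !mxE /= e1 !mul1r mul0r add0r !addr0.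
set q := Num.sqrt (1 + r ^+ 2).
pose v : 'cV[R]_2 := \col_i ((if i == 0 then 1 else r) * q^-1).
have q2 : q ^+ 2 = 1 + r ^+ 2 by rewrite sqr_sqrtr// addr_ge0// sqr_ge0.
have q0 : 0 < q by rewrite sqrtr_gt0; nra.
have v0 : v 0 0 = q^-1 by rewrite mxE /= mul1r.
have v1 : v 1 0 = r * q^-1 by rewrite mxE.
have hub : ubound [set enorm (mx2 1 t 0 1 *m x) | x in [set x | enorm x = 1]] r.
  move=> _ [x /= x1 <-]; rewrite mE.
  have x2 : x 0 0 ^+ 2 + x 1 0 ^+ 2 = 1.
    by rewrite -[RHS](expr1n _ 2) -x1 sqE sqr_sqrtr// addr_ge0// sqr_ge0.
  rewrite -[leRHS](gtr0_norm r0) -sqrtr_sqr ler_wsqrtr//.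
  rewrite -[leRHS]mulr1 -x2.
  rewrite -subr_ge0 -(pmulr_rge0 _ r0).
  rewrite [leRHS](_ : _ = t * (r * x 0 0 - x 1 0) ^+ 2).
    by rewrite mulr_ge0// sqr_ge0.
  move: (x 0 0) (x 1 0) => u w.
  have e0 : r ^+ 2 - (r * t + 1) = 0 by rewrite rE subrr.
  transitivity (t * (r * u - w) ^+ 2 +
      (r ^+ 2 - (r * t + 1)) * (r * (u ^+ 2 + w ^+ 2) + t * w ^+ 2)).
    by ring.
  by rewrite e0 mul0r addr0.
have hmem : [set enorm (mx2 1 t 0 1 *m x) | x in [set x | enorm x = 1]] r.
  exists v => /=.
    rewrite sqE v0 v1 -[RHS]sqrtr1; congr Num.sqrt.
    rewrite exprMn -[X in X + _]mul1r -mulrDl -q2 -exprMn divff ?expr1n//.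
    by rewrite gt_eqF.
  rewrite mE v0 v1 -[RHS](gtr0_norm r0) -sqrtr_sqr; congr Num.sqrt.
  have -> : q^-1 + t * (r * q^-1) = r ^+ 2 * q^-1 by rewrite rE; ring.
  transitivity (r ^+ 2 * (1 + r ^+ 2) / q ^+ 2); first by field; rewrite gt_eqF.
  by rewrite -q2 mulfK// expf_neq0// gt_eqF.
apply/eqP; rewrite eq_le; apply/andP; split.
  by apply: ge_sup => //; exists r.
by apply: ub_le_sup => //; exists r.
Qed.

End facts.

(* Main.v *)
Require Import Defs.
From HB Require Import structures.
From mathcomp Require Import all_boot all_order all_algebra.
From mathcomp Require Import all_classical all_reals all_analysis.
From mathcomp Require Import ring lra.

Set Implicit Arguments.
Unset Strict Implicit.
Unset Printing Implicit Defensive.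

Import Order.TTheory GRing.Theory Num.Theory.
Import numFieldNormedType.Exports.
Local Open Scope classical_set_scope.
Local Open Scope ring_scope.

(** Everything is measured in one well-chosen coordinate system. Right
multiplication of [P1] by a unipotent upper triangular matrix [V] leaves [J1]
unchanged, because [V] commutes with it, and replaces [M] by [M *m V]. When
[c <> 0], [V] can be chosen so that the lower right entry of [M *m V] vanishes;
when [c = 0], take [V = 1]. With [Q = P1 *m V], both conjugates
[Q^-1 A1 Q] and [Q^-1 A2 Q] are then a scalar matrix plus a multiple of a
single off-diagonal unit matrix: [-n1 + E_01], and [n2 + k E_ij] with
[`|k| = d^2] if [c = 0] and [`|k| = c^2] otherwise, because [det M] is
[1] or [-1].

The flow of such a matrix is [exp (l t)] times the shear [1 + k t E_ij], whose
spectral norm is [theta (`|k| t) = exp (asinh (`|k| t / 2))]. Hence, in the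
norm [enorm (Q^-1 x)], a stay of length [t] in mode 1 multiplies the size of a
solution by at most [exp (- g t)], where [g t = n1 t - asinh (t / 2)], and a
stay of length [s] in mode 2 by at most [exp (h s)], where
[h s = n2 s + asinh (`|k| s / 2)] ([shear_flow_growth]). The equation that
defines [tau] is exactly [g tau = h eta].

The function [h] increases, and [g], being convex with [g 0 = 0], increases
from any positive point where it is nonnegative
([decay_exponent_increasing]); this also makes [tau] unique. So each
cycle with [t >= tau] and [s <= eta] multiplies the norm by at most
[exp (h s - g t) <= exp (h eta - g tau) = 1], while the excursion inside a
cycle is bounded by the constant [exp (asinh (tau / 2))]: this is
stability. If the pairs (dwell time in mode 1, dwell time in mode 2) do not
converge to [(tau, eta)], then infinitely many of them are off by a fixed
amount, and each of those cycles contracts by a fixed factor [q < 1]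
([contracting_cycles]), so the norm tends to [0]. *)

(** * The function asinh and the exponent of mode 1 *)

Section asinh_facts.
Variable R : realType.
Implicit Types x y t : R.

Lemma sinh0 : sinh 0 = 0 :> R.
Proof. by rewrite /sinh oppr0 subrr mul0r. Qed.

Lemma asinh0 : asinh 0 = 0 :> R.
Proof. by rewrite -{1}sinh0 sinhK. Qed.

Lemma ltr_sinh x y : (sinh x < sinh y) = (x < y).
Proof.
apply: (leW_mono (f := @sinh R)); apply: le_mono => {}x {}y xy.
by rewrite /sinh ltr_pM2r// ltrD// ?ltrN2 ltr_expR// ltrN2.
Qed.

Lemma ltr_asinh x y : (asinh x < asinh y) = (x < y).
Proof. by rewrite -ltr_sinh !asinhK. Qed.

Lemma ler_asinh x y : (asinh x <= asinh y) = (x <= y).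
Proof. by rewrite !leNgt ltr_asinh. Qed.

Lemma ln_theta t : 0 <= t -> ln (theta t) = asinh (t / 2).
Proof.
move=> t0; rewrite thetaE// /asinh; congr ln.
have -> : (t / 2) ^+ 2 + 1 = 1 + t ^+ 2 / 4 by field.
set s := Num.sqrt (1 + t ^+ 2 / 4).
have s2 : s ^+ 2 = 1 + t ^+ 2 / 4.
  by rewrite sqr_sqrtr// addr_ge0// divr_ge0// sqr_ge0.
have s0 : 0 <= s by exact: sqrtr_ge0.
have -> : 1 + t ^+ 2 / 2 + t * s = (t / 2 + s) ^+ 2 by nra.
by rewrite sqrtr_sqr ger0_norm// addr_ge0// divr_ge0.
Qed.

(** On the positive axis the function is convex and vanishes at [0]: its slope
is nonnegative at some point below [y], hence positive beyond [y]. *)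
Lemma sinh_cvx_increasing (k y y' : R) :
  0 < k -> 0 < y -> 0 <= k * sinh y - y -> y < y' ->
  k * sinh y - y < k * sinh y' - y'.
Proof.
move=> k0 y0 gy yy'.
pose f z : R := k * sinh z - z.
pose df z : R := k * ((expR z + expR (- z)) / 2) - 1.
have fd (z : R) : is_derive z 1 f (df z).
  rewrite /f /df /sinh.
  apply: is_derive_eq; rewrite /GRing.scale/=.
  by field.
have fc : continuous f.
  move=> w; apply: differentiable_continuous; apply/derivable1_diffP.
  exact: (@ex_derive _ _ _ _ _ _ _ (fd w)).
have f0 : f 0 = 0 by rewrite /f sinh0 mulr0 subr0.
have [c1 c1I e1] := MVT y0 (fun z _ => fd z) (continuous_subspaceT fc).
have [c2 c2I e2] := MVT yy' (fun z _ => fd z) (continuous_subspaceT fc).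
have [c10 c1y] : 0 < c1 /\ c1 < y by move: c1I; rewrite in_itv => /andP[].
have yc2 : y < c2 by move: c2I; rewrite in_itv => /andP[].
have d1 : 0 <= df c1.
  by rewrite -(pmulr_lge0 _ y0) -[y in X in _ * X]subr0 -e1 f0 subr0.
have d12 : df c1 < df c2.
  rewrite /df ltrD2r ltr_pM2l// ltr_pM2r//.
  have c12 : expR c1 < expR c2 by rewrite ltr_expR (lt_trans c1y).
  have c1g : 1 < expR c1 by rewrite expR_gt1.
  rewrite !expRN -subr_gt0.
  rewrite (_ : _ - _ =
    (expR c2 - expR c1) * (1 - (expR c1 * expR c2)^-1)); last first.
    by field; rewrite !gt_eqF// expR_gt0.
  rewrite mulr_gt0 ?subr_gt0// invf_lt1; nra.
have df2 := le_lt_trans d1 d12.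
by rewrite -subr_gt0 (_ : _ - _ = f y' - f y)// e2 mulr_gt0// subr_gt0.
Qed.

(** The substitution [t = 2 sinh y] turns the exponent into the function of
[sinh_cvx_increasing]. *)
Lemma decay_exponent_increasing (n t t' : R) :
  0 < n -> 0 < t -> 0 <= n * t - asinh (t / 2) -> t < t' ->
  n * t - asinh (t / 2) < n * t' - asinh (t' / 2).
Proof.
move=> n0 t0 gt tt'.
have eqE s : n * s - asinh (s / 2) =
    2 * n * sinh (asinh (s / 2)) - asinh (s / 2) by rewrite asinhK; field.
rewrite !eqE; apply: sinh_cvx_increasing; rewrite -?eqE ?mulr_gt0//.
  by rewrite -asinh0 ltr_asinh divr_gt0.
by rewrite ltr_asinh ltr_pM2r.
Qed.

Lemma decay_exponent_onto (n r : R) : 0 < n -> 0 < r ->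
  exists2 t, 0 < t & n * t - asinh (t / 2) = r.
Proof.
move=> n0 r0.
pose f y : R := 2 * n * sinh y - y.
(* [Y >= 1] is large enough for the quadratic lower bound of [expR] to give
   [f Y >= r]. *)
pose Y : R := 2 * (1 + r) / n + 1.
have Y1 : 1 <= Y by rewrite lerDr divr_ge0 ?mulr_ge0 ?addr_ge0 ?ltW.
have Y0 : 0 <= Y by rewrite (le_trans _ Y1).
have fY : r <= f Y.
  have nY : 2 * (1 + r) <= n * Y.
    rewrite /Y [n * _]mulrDr mulr1 [n * (_ / _)]mulrC divfK ?gt_eqF// lerDl.
    exact: ltW.
  have eY : 1 + Y ^+ 2 / 2 <= expR Y by exact: (expR_ge1Dxn 1).
  have e1 : expR (- Y) <= 1 by rewrite expR_le1 oppr_le0.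
  rewrite /f /sinh; nra.
have fc : continuous f.
  move=> y; apply: differentiable_continuous; apply/derivable1_diffP.
  by rewrite /f /sinh.
have [|y] := IVT Y0 (continuous_subspaceT fc) (v := r).
  have f0 : f 0 = 0 by rewrite /f sinh0 mulr0 subr0.
  by rewrite f0 min_l ?max_r ?(ltW r0)//= ?(le_trans (ltW r0)).
rewrite in_itv/= => /andP[y0 _] fy.
exists (2 * sinh y).
  rewrite mulr_gt0// -sinh0 ltr_sinh lt_neqAle y0 andbT.
  by apply: contra_eq_neq fy => <-; rewrite /f sinh0 mulr0 subr0 lt_eqF.
have -> : 2 * sinh y / 2 = sinh y by field.
by rewrite sinhK -fy /f; ring.
Qed.

End asinh_facts.

(** * Flow of a scalar matrix plus a shear *)

Section shear_flow.
Variable R : realType.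

Lemma constant_on_segment (f : R -> R) (a b : R) : a <= b ->
  (forall x, x \in `]a, b[ -> is_derive x 1 f 0) ->
  {within `[a, b], continuous f} -> f b = f a.
Proof.
move=> ab fd fc; have [c _] := MVT_segment ab fd fc.
by rewrite mul0r => /eqP; rewrite subr_eq0 => /eqP.
Qed.

(** [(u, v)] is compared with the explicit flow: applying the inverse of the
flow to it gives a pair with zero derivative. *)
Lemma jordan_flow (l k a b : R) (u v : R -> R) : a <= b ->
  {within `[a, b], continuous u} -> {within `[a, b], continuous v} ->
  (forall s, s \in `]a, b[ -> is_derive s 1 u (l * u s + k * v s)) ->
  (forall s, s \in `]a, b[ -> is_derive s 1 v (l * v s)) ->
  v b = expR (l * (b - a)) * v a /\
  u b = expR (l * (b - a)) * (u a + k * (b - a) * v a).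
Proof.
move=> ab uc vc ud vd.
pose e s : R := expR (- (l * (s - a))).
have ed (s : R) : is_derive s 1 e (- l * e s).
  rewrite /e.
  have h : is_derive s 1 (fun s => - (l * (s - a))) (- l).
    by apply: is_derive_eq; rewrite /GRing.scale/=; ring.
  have := is_derive1_comp (is_derive_expR _) h.
  by rewrite /comp mulrC.
have ec : continuous e.
  move=> w; apply: differentiable_continuous; apply/derivable1_diffP.
  exact: (@ex_derive _ _ _ _ _ _ _ (ed w)).
have ew : {within `[a, b], continuous e} by exact: continuous_subspaceT.
have eb x y : e b * x = y -> x = expR (l * (b - a)) * y.
  by move=> <-; rewrite /e expRN mulrA divff ?mul1r// gt_eqF// expR_gt0.
have ea : e a = 1 by rewrite /e subrr mulr0 oppr0 expR0.
have vE : v b = expR (l * (b - a)) * v a.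
  apply: eb; rewrite -[RHS]mul1r -ea.
  apply: (@constant_on_segment (fun s => e s * v s) _ _ ab).
    move=> s /vd vds; have := is_deriveM (ed s) vds.
    by move=> /is_derive_eq; apply; rewrite /GRing.scale/=; ring.
  by move=> s; apply: cvgM; [exact: ew|exact: vc].
pose G (s : R) : R := e s * (u s - k * (s - a) * v s).
have uE : G b = u a.
  transitivity (G a); last by rewrite /G ea subrr; ring.
  apply: (constant_on_segment ab).
    move=> s sab; have [us vs] := (ud _ sab, vd _ sab).
    have h : is_derive s 1 (fun s => k * (s - a)) k.
      by apply: is_derive_eq; rewrite /GRing.scale/=; ring.
    have := is_deriveM (ed s) (is_deriveB us (is_deriveM h vs)).
    by move=> /is_derive_eq; apply; rewrite /GRing.scale/= !fctE; ring.
  move=> s; apply: cvgM; first exact: ew.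
  apply: cvgB; first exact: uc.
  apply: cvgM; last exact: vc.
  move: s; apply: continuous_subspaceT => s.
  by apply: cvgM; [exact: cvg_cst|apply: cvgB; [exact: cvg_id|exact: cvg_cst]].
split=> //; apply/eqP; rewrite -subr_eq0; apply/eqP.
by move/eb: uE => uE; rewrite -[u b](subrK (k * (b - a) * v b)) uE vE; ring.
Qed.

(** The factor [r] is the norm of the shear: [r] and [r^-1] are its singular
values, whose difference is [`|w|], so [r ^+ 2 = r * `|w| + 1]. This relation
makes [r] times the difference of the two sides the square
[w * (r * p - q) ^+ 2] when [w >= 0]; changing the sign of [q] handles
[w < 0]. *)
Lemma shear_sqr_norm_le (w p q : R) :
  (p + w * q) ^+ 2 + q ^+ 2 <=
  expR (asinh (`|w| / 2)) ^+ 2 * (p ^+ 2 + q ^+ 2).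
Proof.
set r := expR _.
have r0 : 0 < r by exact: expR_gt0.
have rE : r ^+ 2 = r * `|w| + 1.
  have := asinhK (`|w| / 2); rewrite {1}/sinh expRN -/r.
  move=> /(congr1 (fun x => x * (2 * r))).
  have -> : (r - r^-1) / 2 * (2 * r) = r ^+ 2 - 1 by field; rewrite gt_eqF.
  by move=> h; rewrite -(subrK 1 (r ^+ 2)) h; congr (_ + _); field.
rewrite -subr_ge0.
have key (z y : R) : 0 <= z -> r ^+ 2 = r * z + 1 ->
    0 <= r ^+ 2 * (p ^+ 2 + y ^+ 2) - ((p + z * y) ^+ 2 + y ^+ 2).
  move=> z0 rz; rewrite -(pmulr_rge0 _ r0).
  rewrite [leRHS](_ : _ = z * (r * p - y) ^+ 2 +
      (r ^+ 2 - (r * z + 1)) * (r * (p ^+ 2 + y ^+ 2) + z * y ^+ 2));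
    last by ring.
  by rewrite -rz subrr mul0r addr0 mulr_ge0// sqr_ge0.
have [w0|w0] := leP 0 w.
  by apply: key => //; rewrite -[X in r * X](ger0_norm w0).
have := key (- w) (- q); rewrite oppr_ge0 (ltW w0) sqrrN mulrNN; apply=> //.
by rewrite -(ltr0_norm w0).
Qed.

Lemma enormE (x : 'cV[R]_2) (i j : 'I_2) : i != j ->
  enorm x = Num.sqrt (x i 0 ^+ 2 + x j 0 ^+ 2).
Proof.
move=> ij; rewrite /enorm (bigD1 i)//= (bigD1 j) 1?eq_sym//= big1 ?addr0// => l.
case: i j l ij => [[|[|//]] ?] [[|[|//]] ?] [[|[|//]] ?]; by rewrite //= /eq_op/=.
Qed.

Lemma is_derive_coord (x : R -> 'cV[R]_2) (t : R) (dx : 'cV[R]_2)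
    (B : 'M[R]_2) i :
  is_derive t 1 x dx -> is_derive t 1 (fun s => (B *m x s) i 0) ((B *m dx) i 0).
Proof.
move=> [xd xD].
have cd (j : 'I_2) : is_derive t 1 (fun s => x s j 0) (dx j 0).
  by split; [move/derivable_mxP: xd; apply|rewrite -xD derive_mx// mxE].
have := is_derive_sum (fun j => is_deriveZ (B i j) (cd j)).
rewrite mxE; congr (is_derive _ _ _ _); apply/funext => s.
by rewrite fct_sumE mxE.
Qed.

Lemma continuous_coord (x : R -> 'cV[R]_2) (B : 'M[R]_2) i (A : set R) :
  {within A, continuous x} -> {within A, continuous (fun s => (B *m x s) i 0)}.
Proof.
move=> xc s.
rewrite (_ : (fun _ => _) = fun s => \sum_j B i j * x s j 0); last first.
  by apply/funext => z; rewrite mxE.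
apply: cvg_big => [|j _]; first exact: add_continuous.
apply: cvgM; first exact: cvg_cst.
exact: (cvg_comp _ _ (xc s) (@coord_continuous R 2 1 j 0 (x s))).
Qed.

(** In the coordinates [invmx Q *m x] the equation is a Jordan block, up to
the order of the two coordinates: leaving [i] and [j] free covers upper and
lower triangular blocks at once. *)
Lemma shear_flow_growth (A Q : 'M[R]_2) (i j : 'I_2) (l k a b : R)
    (x : R -> 'cV[R]_2) :
  i != j -> Q \in unitmx -> A *m Q = Q *m (l%:M + k *: delta_mx i j) ->
  a <= b -> {within `[a, b], continuous x} ->
  (forall s, s \in `]a, b[ -> is_derive s 1 x (A *m x s)) ->
  enorm (invmx Q *m x b) <=
    expR (l * (b - a) + asinh (`|k| * (b - a) / 2)) * enorm (invmx Q *m x a).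
Proof.
move=> ij uQ AQ ab xc xd.
have zd s : s \in `]a, b[ -> forall m,
    is_derive s 1 (fun s => (invmx Q *m x s) m 0)
      (((l%:M + k *: delta_mx i j) *m (invmx Q *m x s)) m 0).
  move=> /xd h m; have := is_derive_coord (invmx Q) m h.
  by rewrite -[X in A *m X](mulKVmx uQ) [A *m _]mulmxA AQ -mulmxA mulKmx.
have BE (y : 'cV[R]_2) m :
    ((l%:M + k *: delta_mx i j) *m y) m 0 =
    l * y m 0 + (m == i)%:R * k * y j 0.
  rewrite mulmxDl mul_scalar_mx -scalemxAl !mxE; congr (_ + _).
  rewrite (bigD1 j)//= big1 ?addr0 ?mxE ?eqxx ?andbT.
    by rewrite mulrA [k * _]mulrC.
  by move=> r rj; rewrite mxE (negbTE rj) andbF mul0r.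
have [||s sI|s sI|vb ub] := @jordan_flow l k a b
  (fun s => (invmx Q *m x s) i 0) (fun s => (invmx Q *m x s) j 0) ab.
- exact: continuous_coord.
- exact: continuous_coord.
- by have := zd _ sI i; rewrite BE eqxx mul1r.
- by have := zd _ sI j; rewrite BE eq_sym (negbTE ij) !mul0r addr0.
rewrite !(enormE _ ij) ub vb expRD -[leRHS]mulrA.
set E := expR (l * _); set e := expR _; have E0 : 0 <= E by exact: expR_ge0.
have e0 : 0 <= e by exact: expR_ge0.
rewrite !exprMn -mulrDr sqrtrM ?sqr_ge0// sqrtr_sqr ger0_norm//.
rewrite ler_wpM2l//.
rewrite -[X in _ <= X * _](ger0_norm e0) -sqrtr_sqr -sqrtrM ?sqr_ge0//.
apply: ler_wsqrtr; rewrite /e.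
have -> : `|k| * (b - a) = `|k * (b - a)|.
  by rewrite normrM [X in _ = _ * X]ger0_norm// subr_ge0.
exact: shear_sqr_norm_le.
Qed.

Lemma enorm_mulmx_le (B : 'M[R]_2) :
  exists2 C, 0 < C & forall x : 'cV[R]_2, enorm (B *m x) <= C * enorm x.
Proof.
pose S : R := \sum_i \sum_j B i j ^+ 2.
have S0 : 0 <= S.
  by apply: sumr_ge0 => i _; apply: sumr_ge0 => j _; rewrite sqr_ge0.
(* [S] bounds the square of the norm of [B], and [S <= (1 + S) ^+ 2]. *)
exists (1 + S) => [|x]; first by rewrite ltr_pwDl.
have S1 : 0 <= 1 + S by rewrite addr_ge0.
have ij : (0 : 'I_2) != 1 by [].
rewrite !(enormE _ ij) -[X in X * _](ger0_norm S1) -sqrtr_sqr -sqrtrM ?sqr_ge0//.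
apply: ler_wsqrtr.
have SS : S <= (1 + S) ^+ 2 by nra.
apply: le_trans (ler_wpM2r _ SS); last by rewrite addr_ge0// sqr_ge0.
rewrite /S !mxE !big_ord_recl !big_ord0.
have -> : lift ord0 ord0 = 1 :> 'I_2 by exact: val_inj.
set p := x _ _; set q := x 1 0.
rewrite !addr0.
have cs (m n : R) :
    (m * p + n * q) ^+ 2 <= (m ^+ 2 + n ^+ 2) * (p ^+ 2 + q ^+ 2).
  by rewrite -subr_ge0 (_ : _ - _ = (m * q - n * p) ^+ 2) ?sqr_ge0//; ring.
by rewrite mulrDl lerD.
Qed.

End shear_flow.

(** * Switching signals *)

Section signal_facts.
Variables (R : realType) (A1 A2 : 'M[R]_2) (sigma : signal R).
Local Notation d := (sig_time sigma).

Lemma sig_time_homo : {homo d : j k / (j < k)%N >-> j < k}.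
Proof. by apply: homo_ltn => [? ? ?|]; [exact: lt_trans|exact: sig_time_lt]. Qed.

Lemma sig_time_mono : {mono d : j k / (j <= k)%N >-> j <= k}.
Proof. exact: le_mono sig_time_homo. Qed.

Lemma sig_time_lt_mono : {mono d : j k / (j < k)%N >-> j < k}.
Proof. exact: leW_mono sig_time_mono. Qed.

Lemma sig_time_ge0 k : 0 <= d k.
Proof. by rewrite -(sig_time0 sigma) sig_time_mono. Qed.

Lemma mode_altern : sigma 0 = Mode1 -> forall k,
  sigma (d k.*2) = Mode1 /\ sigma (d k.*2.+1) = Mode2.
Proof.
move=> s0 k.
have step1 j : sigma (d j) = Mode1 -> sigma (d j.+1) = Mode2.
  by move=> e; have := @sig_jump _ sigma j; rewrite e; case: (sigma _).
have step2 j : sigma (d j) = Mode2 -> sigma (d j.+1) = Mode1.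
  by move=> e; have := @sig_jump _ sigma j; rewrite e; case: (sigma _).
elim: k => [|k [_ IH]].
  by rewrite double0 (sig_time0 sigma); split=> //; rewrite step1// sig_time0.
by rewrite doubleS; split; [exact: step2|exact/step1/step2].
Qed.

Lemma sig_time_cofinal t : exists k, t < d k.
Proof.
have /cvgryPgt /(_ t)[k _ /(_ k)/=] := sig_time_pinfty sigma.
by move=> /(_ (leqnn k)); exists k.
Qed.

Lemma sig_cycle_locate t : 0 <= t -> exists k, d k.*2 <= t < d k.+1.*2.
Proof.
move=> t0.
have ex : exists k, t < d k.*2.
  have [k tk] := sig_time_cofinal t; exists k; apply: lt_le_trans tk _.
  by rewrite sig_time_mono -addnn leq_addr.
case: (ex_minnP ex) => -[|k]; first by rewrite double0 sig_time0 ltNge t0.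
move=> tk kmin; exists k; rewrite tk andbT leNgt; apply/negP => /kmin.
by rewrite ltnn.
Qed.

Lemma solution_on_dwell x k t :
  is_solution A1 A2 sigma x -> d k <= t <= d k.+1 ->
  {within `[d k, t], continuous x} /\
  forall s, s \in `]d k, t[ ->
    is_derive s 1 x (mode_mx A1 A2 (sigma (d k)) *m x s).
Proof.
move=> [xc xd] /andP[kt tk]; split.
  apply: continuous_subspaceW xc => s /=; rewrite !in_itv/= andbT => /andP[ks _].
  exact: le_trans (sig_time_ge0 k) ks.
move=> s; rewrite in_itv/= => /andP[ks st].
have sk : s < d k.+1 by exact: lt_le_trans tk.
rewrite -(@sig_const _ sigma k s); last by rewrite ltW.
apply: xd; first exact: le_lt_trans (sig_time_ge0 k) ks.
move=> j; apply/negP => /eqP sj; move: ks sk; rewrite sj.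
by rewrite !sig_time_lt_mono ltnS => kj /(leq_trans kj); rewrite ltnn.
Qed.

End signal_facts.

(** * Cycles in mode 1 followed by mode 2 *)

Lemma cvg0_contraction (R : realType) (a : nat -> R) (q : R) :
  (forall k, 0 <= a k) -> (forall k, a k.+1 <= a k) -> 0 <= q < 1 ->
  (forall N, exists2 k, (N <= k)%N & a k.+1 <= q * a k) ->
  a k @[k --> \oo] --> 0.
Proof.
move=> a0 adec /andP[q0 q1] aq.
have amono : {homo a : j k / (j <= k)%N >-> k <= j}.
  by apply: homo_leq => [?|? ? ? xy yz|] //; exact: le_trans yz xy.
have geo m : exists N, a N <= q ^+ m * a 0%N.
  elim: m => [|m [N IH]]; first by exists 0%N; rewrite expr0 mul1r.
  have [k Nk ak] := aq N; exists k.+1; apply: (le_trans ak).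
  by rewrite exprS -mulrA ler_wpM2l// (le_trans _ IH)// amono.
apply/cvgrPdist_lt => e e0.
have : geometric (a 0%N) q @ \oo --> 0 by apply: cvg_geometric; rewrite ger0_norm.
move=> /cvgrPdist_lt/(_ _ e0)[m _ /(_ m (leqnn m))/=].
rewrite sub0r normrN ger0_norm ?mulr_ge0 ?exprn_ge0// => me.
have [N aN] := geo m; exists N => // k /= Nk.
rewrite sub0r normrN ger0_norm// (le_lt_trans (amono _ _ Nk))//.
by rewrite (le_lt_trans aN)// mulrC.
Qed.

(** The general situation behind both cases of the theorem: in the coordinates
given by [Q], mode 1 is a decaying and mode 2 a growing shear flow. *)
Section switched_shears.
Variables (R : realType) (A1 A2 Q : 'M[R]_2) (i j : 'I_2) (n1 n2 k tau eta : R).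
Hypotheses (n1_gt0 : 0 < n1) (n2_ge0 : 0 <= n2) (k_neq0 : k != 0).
Hypotheses (tau_gt0 : 0 < tau) (eta_gt0 : 0 < eta).
Hypotheses (Q_unit : Q \in unitmx) (ij : i != j).
Hypothesis A1Q : A1 *m Q = Q *m ((- n1)%:M + 1 *: delta_mx 0 1).
Hypothesis A2Q : A2 *m Q = Q *m (n2%:M + k *: delta_mx i j).

Let decay t : R := n1 * t - asinh (t / 2).
Let growth s : R := n2 * s + asinh (`|k| * s / 2).

Hypothesis balanced : decay tau = growth eta.

Let growth_increasing : {homo growth : s s' / s < s'}.
Proof.
move=> s s' ss'; apply: ler_ltD; first by rewrite ler_wpM2l// ltW.
by rewrite ltr_asinh ltr_pM2r// ltr_pM2l// normr_gt0.
Qed.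

Let growth_ge0 s : 0 <= s -> 0 <= growth s.
Proof.
move=> s0; rewrite addr_ge0 ?mulr_ge0// -[leLHS](@asinh0 R) ler_asinh.
by rewrite divr_ge0// mulr_ge0.
Qed.

Let decay_increasing t t' : tau <= t -> t < t' -> decay t < decay t'.
Proof.
move=> tt tt'; have dtau : 0 <= decay tau by rewrite balanced growth_ge0 ?ltW.
apply: decay_exponent_increasing => //; first exact: lt_le_trans tt.
move: tt; rewrite le_eqVlt => /predU1P[<-//|tt].
apply: (le_trans dtau); apply/ltW; exact: decay_exponent_increasing.
Qed.

Let decay_ge t : tau <= t -> decay tau <= decay t.
Proof.
by rewrite le_eqVlt => /predU1P[<-//|tt]; apply/ltW/decay_increasing.
Qed.

Section solution.
Variables (sigma : signal R) (x : R -> 'cV[R]_2).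
Hypotheses (sigmaP : dwell_flee tau eta sigma) (xP : is_solution A1 A2 sigma x).
Local Notation d := (sig_time sigma).
Let N t := enorm (invmx Q *m x t).

Let N_ge0 t : 0 <= N t. Proof. exact: sqrtr_ge0. Qed.

Lemma decay_phase m t : d m.*2 <= t <= d m.*2.+1 ->
  N t <= expR (- decay (t - d m.*2)) * N (d m.*2).
Proof.
move=> mt; have [xc xd] := solution_on_dwell xP mt.
case: sigmaP => s0 _; have [s1 _] := mode_altern s0 m.
rewrite s1 /= in xd; case/andP: mt => mt _.
have := shear_flow_growth _ Q_unit A1Q mt xc xd; rewrite normr1 mul1r.
by rewrite /decay opprB addrC mulNr => ->.
Qed.

Lemma growth_phase m t : d m.*2.+1 <= t <= d m.*2.+2 ->
  N t <= expR (growth (t - d m.*2.+1)) * N (d m.*2.+1).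
Proof.
move=> mt; have [xc xd] := solution_on_dwell xP mt.
case: sigmaP => s0 _; have [_ s1] := mode_altern s0 m.
rewrite s1 /= in xd; case/andP: mt => mt _.
exact: shear_flow_growth ij Q_unit A2Q mt xc xd.
Qed.

Lemma cycle_ratio m : N (d m.+1.*2) <=
  expR (growth (dwell2 sigma m) - decay (dwell1 sigma m)) * N (d m.*2).
Proof.
rewrite doubleS expRD -mulrA.
have mm : d m.*2.+1 <= d m.*2.+2 <= d m.*2.+2.
  by rewrite lexx sig_time_mono leqnSn.
apply: (le_trans (growth_phase mm)).
rewrite ler_wpM2l ?expR_ge0//.
by apply: decay_phase; rewrite lexx sig_time_mono leqnSn.
Qed.

Lemma growth_le_decay m : growth (dwell2 sigma m) <= decay (dwell1 sigma m).
Proof.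
case: sigmaP => _ /(_ m)[t1 t2].
apply: le_trans (decay_ge t1); rewrite balanced.
by move: t2; rewrite le_eqVlt => /predU1P[->//|/growth_increasing/ltW].
Qed.

Lemma cycle_nonincreasing m : N (d m.+1.*2) <= N (d m.*2).
Proof.
apply: (le_trans (cycle_ratio m)); rewrite ler_piMl//.
by rewrite expR_le1 subr_le0 growth_le_decay.
Qed.

(** In mode 1, [- decay] is at most [asinh (tau / 2)] on [[0, tau]] and
nonpositive later. In mode 2 the growth so far is at most that of the complete
stay, which the preceding decay compensates. *)
Lemma cycle_overshoot m t : d m.*2 <= t <= d m.+1.*2 ->
  N t <= expR (asinh (tau / 2)) * N (d m.*2).
Proof.
have c1 : 1 <= expR (asinh (tau / 2)).
  by rewrite -[leLHS]expR0 ler_expR -[leLHS](@asinh0 R) ler_asinh divr_ge0 ?ltW.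
move=> /andP[mt tm]; have [tm1|tm1] := leP t (d m.*2.+1).
  apply: (le_trans (decay_phase (m := m) _)); first by rewrite mt.
  rewrite ler_wpM2r// ler_expR.
  have [s_tau|tau_s] := leP (t - d m.*2) tau.
    rewrite /decay opprB lerBlDr; apply: (@le_trans _ _ (asinh (tau / 2))).
      by rewrite ler_asinh ler_pM2r.
    by rewrite lerDl mulr_ge0 ?subr_ge0 ?(ltW n1_gt0).
  apply: (@le_trans _ _ 0).
    rewrite oppr_le0 (le_trans _ (decay_ge (ltW tau_s)))//.
    by rewrite balanced growth_ge0 ?ltW.
  by rewrite -[leLHS](@asinh0 R) ler_asinh divr_ge0 ?ltW.
rewrite doubleS in tm.
apply: (le_trans (growth_phase (m := m) _)); first by rewrite ltW.
apply: (@le_trans _ _ (1 * N (d m.*2))); last by rewrite ler_wpM2r.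
apply: (@le_trans _ _ (expR (growth (dwell2 sigma m)) *
    (expR (- decay (dwell1 sigma m)) * N (d m.*2)))).
  apply: ler_pM; rewrite ?expR_ge0//; last first.
    by apply: decay_phase; rewrite lexx sig_time_mono leqnSn.
  rewrite ler_expR; have : t - d m.*2.+1 <= dwell2 sigma m by rewrite lerD2r.
  by rewrite le_eqVlt => /predU1P[->//|/growth_increasing/ltW].
by rewrite mulrA -expRD ler_wpM2r// expR_le1 subr_le0 growth_le_decay.
Qed.

Lemma cycle_le_initial m : N (d m.*2) <= N 0.
Proof.
elim: m => [|m IH]; first by rewrite double0 sig_time0.
exact: le_trans (cycle_nonincreasing m) IH.
Qed.

Lemma transient_bound t : 0 <= t -> N t <= expR (asinh (tau / 2)) * N 0.
Proof.
move=> /(sig_cycle_locate sigma)[m /andP[mt tm]].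
apply: (le_trans (cycle_overshoot (m := m) _)); first by rewrite mt ltW.
by rewrite ler_wpM2l ?expR_ge0// cycle_le_initial.
Qed.

(** As [dwell1 >= tau] and [dwell2 <= eta], failure of convergence means that,
for some [e > 0], infinitely often [dwell1 >= tau + e] or
[dwell2 <= eta - e]. Strict monotonicity of the exponents then gives a gain
that depends on [e] only. *)
Lemma contracting_cycles :
  ~ ((dwell1 sigma m, dwell2 sigma m) @[m --> \oo] --> (tau, eta)) ->
  exists2 q : R, 0 <= q < 1 &
    forall M, exists2 m, (M <= m)%N & N (d m.+1.*2) <= q * N (d m.*2).
Proof.
move=> ncvg.
have [e e0 far] : exists2 e : R, 0 < e & forall M, exists2 m, (M <= m)%N &
    tau + e <= dwell1 sigma m \/ dwell2 sigma m <= eta - e.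
  apply: contrapT => nfar; apply: ncvg.
  have near (e : R) : 0 < e -> exists M, forall m, (M <= m)%N ->
      `|tau - dwell1 sigma m| < e /\ `|eta - dwell2 sigma m| < e.
    move=> e0; apply: contrapT => nM; apply: nfar; exists e => // M.
    apply: contrapT => nm; apply: nM; exists M => m Mm.
    have [h1 h2] : dwell1 sigma m < tau + e /\ eta - e < dwell2 sigma m.
      by rewrite !ltNge; split; apply/negP => h; apply: nm; exists m => //;
        [left|right].
    case: sigmaP => _ /(_ m)[g1 g2].
    by rewrite !ltr_norml; split; apply/andP; split; lra.
  have cvg1 : dwell1 sigma m @[m --> \oo] --> tau.
    by apply/cvgrPdist_lt => e /near[M HM]; exists M => // m /= /HM[].
  have cvg2 : dwell2 sigma m @[m --> \oo] --> eta.
    by apply/cvgrPdist_lt => e /near[M HM]; exists M => // m /= /HM[].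
  exact: cvg_pair cvg1 cvg2.
pose delta :=
  Num.min (decay (tau + e) - decay tau) (growth eta - growth (eta - e)).
have delta0 : 0 < delta.
  rewrite lt_min !subr_gt0 decay_increasing ?ltrDl//=.
  by apply: growth_increasing; rewrite gtrDl oppr_lt0.
exists (expR (- delta)).
  by rewrite expR_ge0 expR_lt1 oppr_lt0.
move=> M; have [m Mm Hm] := far M; exists m => //.
apply: (le_trans (cycle_ratio m)); rewrite ler_wpM2r// ler_expR.
rewrite lerNr opprB.
case: sigmaP => _ /(_ m)[g1 g2].
have d1 := decay_ge g1.
have homoW := ltW_homo growth_increasing.
have d2 := homoW _ _ g2.
case: Hm => h.
  have d3 : decay (tau + e) <= decay (dwell1 sigma m).
    move: h; rewrite le_eqVlt => /predU1P[->//|h].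
    by apply/ltW/decay_increasing => //; rewrite lerDl ltW.
  have : delta <= decay (tau + e) - decay tau by rewrite ge_min lexx.
  by move: balanced; lra.
have d3 := homoW _ _ h.
have : delta <= growth eta - growth (eta - e) by rewrite ge_min lexx orbT.
by move: balanced; lra.
Qed.

Lemma solution_vanishes :
  ~ ((dwell1 sigma m, dwell2 sigma m) @[m --> \oo] --> (tau, eta)) ->
  N t @[t --> +oo] --> 0.
Proof.
move=> /contracting_cycles[q q01 Hq].
have /cvgrPdist_lt a0 := cvg0_contraction (fun m => N_ge0 (d m.*2))
  cycle_nonincreasing q01 Hq.
have C0 : 0 < expR (asinh (tau / 2)) by exact: expR_gt0.
apply/cvgrPdist_lt => e e0.
have [m _ /(_ _)/= Hm] := a0 _ (divr_gt0 e0 C0).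
exists (d m.*2); split; first exact: num_real.
move=> t mt; rewrite sub0r normrN ger0_norm//.
have t0 : 0 <= t by exact: le_trans (sig_time_ge0 sigma _) (ltW mt).
have [p /andP[pt tp]] := sig_cycle_locate sigma t0.
apply: (le_lt_trans (cycle_overshoot (m := p) _)); first by rewrite pt ltW.
rewrite mulrC -ltr_pdivlMr//.
have := Hm p; rewrite sub0r normrN ger0_norm//; apply.
have : d m.*2 < d p.+1.*2 by exact: lt_trans tp.
by rewrite sig_time_lt_mono ltn_double ltnS.
Qed.

End solution.

Lemma switched_shears_stable sigma : dwell_flee tau eta sigma ->
  stable A1 A2 sigma.
Proof.
move=> sP e e0.
have [C C0 QC] := enorm_mulmx_le Q.
have [C' C'0 QC'] := enorm_mulmx_le (invmx Q).
set E := expR (asinh (tau / 2)); have E0 : 0 < E by exact: expR_gt0.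
exists (e / (C * E * C')) => [|x xP]; first by rewrite !(divr_gt0, mulr_gt0).
rewrite ltr_pdivlMr ?mulr_gt0// => x0 t t0.
apply: le_lt_trans x0; rewrite -[x t](mulKVmx Q_unit).
apply: (le_trans (QC _)).
have -> : enorm (x 0) * (C * E * C') = C * (E * (C' * enorm (x 0))) by ring.
rewrite ler_wpM2l ?(ltW C0)// (le_trans (transient_bound sP xP (ltW t0)))//.
by rewrite ler_wpM2l ?(ltW E0).
Qed.

Lemma switched_shears_asymptotically_stable sigma : dwell_flee' tau eta sigma ->
  asymptotically_stable A1 A2 sigma.
Proof.
move=> [sP ncvg]; split; first exact: switched_shears_stable.
move=> x xP; have [C C0 QC] := enorm_mulmx_le Q.
have bound : C * enorm (invmx Q *m x t) @[t --> +oo] --> 0.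
  rewrite -(mulr0 C); apply: cvgM; first exact: cvg_cst.
  exact: (solution_vanishes sP xP ncvg).
apply: (squeeze_cvgr _ (cvg_cst 0) bound).
near=> t; rewrite sqrtr_ge0/=.
by rewrite -{1}[x t](mulKVmx Q_unit).
Unshelve. all: by end_near. Qed.

End switched_shears.

(** * Adapted coordinates and conclusion *)

Lemma mx2_mul (R : realType) (a b c d a' b' c' d' : R) :
  mx2 a b c d *m mx2 a' b' c' d' =
  mx2 (a * a' + b * c') (a * b' + b * d') (c * a' + d * c') (c * b' + d * d').
Proof.
apply/matrixP => -[[|[|//]] ?] -[[|[|//]] ?];
  by rewrite !mxE !big_ord_recl big_ord0 !mxE /= addr0.
Qed.

Lemma mx2_det (R : realType) (a b c d : R) : \det (mx2 a b c d) = a * d - b * c.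
Proof.
rewrite (expand_det_row _ 0) !big_ord_recl big_ord0 addr0.
by rewrite /cofactor !det_mx11 !mxE/= /bump/= expr0 expr1; ring.
Qed.

Lemma mx2_shearE (R : realType) (l k : R) :
  (mx2 l k 0 l = l%:M + k *: delta_mx 0 1) /\
  (mx2 l 0 k l = l%:M + k *: delta_mx 1 0).
Proof.
by split; apply/matrixP => -[[|[|//]] ?] -[[|[|//]] ?];
  rewrite !mxE /= ?mulr1n ?mulr0n ?mulr1 ?mulr0 ?addr0 ?add0r.
Qed.

Theorem theorem7p1 (R : realType) (n1 n2 eta a b c d : R)
    (P1 P2 A1 A2 : 'M[R]_2)
    (n1_gt0 : 0 < n1) (n2_ge0 : 0 <= n2) (eta_gt0 : 0 < eta)
    (P1_unit : P1 \in unitmx) (P2_unit : P2 \in unitmx)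
    (detP1 : `|\det P1| = 1) (detP2 : `|\det P2| = 1)
    (A1E : A1 = P1 *m mx2 (- n1) 1 0 (- n1) *m invmx P1)
    (A2E : A2 = P2 *m mx2 n2 1 0 n2 *m invmx P2)
    (ME : invmx P2 *m P1 = mx2 a b c d) :
  let is_tau12 (t : R) : Prop :=
    0 < t /\
    (c = 0 -> n1 * t - ln (theta t) = n2 * eta + asinh (d ^+ 2 / 2 * eta)) /\
    (c <> 0 -> n1 * t - ln (theta t) = n2 * eta + asinh (c ^+ 2 / 2 * eta)) in
  (exists! tau12 : R, is_tau12 tau12) /\
  (forall tau12 : R, is_tau12 tau12 ->
    (forall sigma : signal R, dwell_flee tau12 eta sigma ->
      stable A1 A2 sigma) /\
    (forall sigma : signal R, dwell_flee' tau12 eta sigma ->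
      asymptotically_stable A1 A2 sigma)).
Proof.
move=> is_tau12.
have detM : `|a * d - b * c| = 1.
  rewrite -mx2_det -ME det_mulmx normrM det_inv normfV.
  by rewrite detP1 detP2 invr1 mulr1.
have P1E : P1 = P2 *m mx2 a b c d by rewrite -ME mulKVmx.
pose m := if c == 0 then d else c.
(* [V] commutes with [J1], and the lower right entry of [M *m V] is [0] if
   [c != 0]. *)
pose V := mx2 1 (if c == 0 then 0 else - d / c) 0 1.
have [k [i [j [ij kE MV]]]] : exists k (i j : 'I_2), [/\ i != j, `|k| = m ^+ 2 &
    mx2 n2 1 0 n2 *m (mx2 a b c d *m V) =
    mx2 a b c d *m V *m (n2%:M + k *: delta_mx i j)].
  rewrite /V /m; have [c0|c0] := eqVneq c 0.
    have ad1 : `|a| * `|d| = 1 by rewrite -normrM -detM c0 mulr0 subr0.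
    have a0 : a != 0.
      by apply: contra_eq_neq ad1 => ->; rewrite normr0 mul0r eq_sym oner_eq0.
    exists (d / a), 0, 1; split=> //.
      by rewrite -(real_normK (num_real d)) normrM normfV expr2
        -[_^-1]mulr1 -ad1 mulKf ?normr_eq0.
    rewrite -(mx2_shearE _ _).1 !mx2_mul c0.
    by congr (mx2 _ _ _ _); field.
  pose e := b - a * d / c.
  have ec : c * e = - (a * d - b * c) by rewrite /e; field.
  have ec1 : `|c| * `|e| = 1 by rewrite -normrM ec normrN.
  have e0 : e != 0.
    by apply: contra_eq_neq ec1 => ->; rewrite normr0 mulr0 eq_sym oner_eq0.
  exists (c / e), 1, 0; split=> //.
    by rewrite -(real_normK (num_real c)) normrM normfV expr2
      -[_^-1]mul1r -ec1 mulfK ?normr_eq0.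
  have -> : mx2 a b c d *m mx2 1 (- d / c) 0 1 = mx2 a e c 0.
    by rewrite mx2_mul; congr (mx2 _ _ _ _); rewrite /e; field.
  by rewrite -(mx2_shearE _ _).2 !mx2_mul; congr (mx2 _ _ _ _); field.
have m0 : m != 0.
  rewrite /m; case: (eqVneq c 0) => [c0|//]; apply: contra_eq_neq detM => d0.
  by rewrite c0 d0 !mulr0 subr0 normr0 eq_sym oner_eq0.
have k0 : k != 0 by rewrite -normr_gt0 kE exprn_even_gt0.
have V_unit : V \in unitmx.
  by rewrite unitmxE mx2_det !mul1r mulr0 subr0 unitr1.
pose Q := P1 *m V.
have Q_unit : Q \in unitmx by rewrite unitmx_mul P1_unit.
have A1Q : A1 *m Q = Q *m ((- n1)%:M + 1 *: delta_mx 0 1).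
  rewrite A1E /Q -!mulmxA mulKmx// -(mx2_shearE _ _).1; congr (_ *m _).
  by rewrite /V !mx2_mul; congr (mx2 _ _ _ _); ring.
have A2Q : A2 *m Q = Q *m (n2%:M + k *: delta_mx i j).
  by rewrite A2E /Q P1E -!mulmxA mulKmx// MV -mulmxA.
(* The two defining equations of [tau] become a single one in [k]. *)
have tauP t : is_tau12 t <->
    0 < t /\ n1 * t - asinh (t / 2) = n2 * eta + asinh (`|k| * eta / 2).
  rewrite kE /is_tau12 [m ^+ 2 * eta / 2]mulrAC /m.
  split=> -[t0 h]; split=> //; move: h; rewrite ln_theta ?ltW//.
    by case=> [h1 h2]; case: eqVneq => [/h1|/eqP/h2].
  by case: eqVneq => [c0|/eqP c0] h; split.
have rhs_gt0 : 0 < n2 * eta + asinh (`|k| * eta / 2).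
  rewrite ltr_wpDl ?mulr_ge0 ?(ltW eta_gt0)//.
  by rewrite -[ltLHS](@asinh0 R) ltr_asinh !(divr_gt0, mulr_gt0)// normr_gt0.
split; last first.
  move=> t /tauP[t0 tE]; split=> sigma.
    exact: (switched_shears_stable n1_gt0 n2_ge0 k0 t0 eta_gt0
      Q_unit ij A1Q A2Q).
  exact: (switched_shears_asymptotically_stable n1_gt0 n2_ge0 k0 t0 eta_gt0
    Q_unit ij A1Q A2Q).
have [t t0 tE] := decay_exponent_onto n1_gt0 rhs_gt0.
exists t; split; first exact/tauP.
move=> t' /tauP[t'0 t'E]; apply/eqP; rewrite eq_le !leNgt; apply/andP.
split; apply/negP => /[dup] tt' /(decay_exponent_increasing n1_gt0) incr.
  by have := incr t'0; rewrite tE t'E ltxx => /(_ (ltW rhs_gt0)).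
by have := incr t0; rewrite tE t'E ltxx => /(_ (ltW rhs_gt0)).
Qed.
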